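(* Let $\kappa$ be an infinite cardinal, let $(H_\beta)_{\beta\in\kappa}$ be a family of groups, let $G = \bigoplus_{\beta \in \kappa} H_{\beta}$ be their restricted direct product, and let $\lambda = \sup_{\beta\in\kappa}|H_\beta|$, an infinite cardinal. Suppose $|H_{\alpha}| < \lambda$ for every $\alpha \in \kappa$. Then every free subgroup $H \leq G$ satisfies $\mathrm{rank}(H) < \lambda$.
   Context: The restricted direct product $\bigoplus_{\beta\in\kappa}H_\beta$ is the subgroup of the direct product $\prod_{\beta\in\kappa} H_\beta$ consisting of the elements having only finitely many non-identity coordinates. *)

(* Defs.v *)
From HB Require Import structures.
From mathcomp Require Import all_boot.
From mathcomp Require Import boolp classical_sets functions cardinality.

Set Implicit Arguments.
Unset Strict Implicit.
Unset Printing Implicit Defensive.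

Local Open Scope classical_set_scope.
Local Open Scope card_scope.
Local Open Scope group_scope.

(** * Cardinals

    A cardinal is represented by any set (or type) having that cardinality. *)

Definition card_lt T U (A : set T) (B : set U) : bool :=
  (A #<= B) && ~~ (B #<= A).

(* |L| is the least upper bound of the cardinals |A i|. *)
Definition is_card_sup (I : Type) (A : I -> Type) (L : Type) : Prop :=
  (forall i, [set: A i] #<= [set: L]) /\
  (forall M : Type, (forall i, [set: A i] #<= [set: M]) -> [set: L] #<= [set: M]).

(** * Direct products *)

Definition direct_product (I : Type) (H : I -> groupType) : Type :=
  forall i, H i.

Section DirectProduct.
Variables (I : Type) (H : I -> groupType).
Local Notation P := (direct_product H).

HB.instance Definition _ := gen_eqMixin P.
HB.instance Definition _ := gen_choiceMixin P.

Definition dp_one : P := fun i => 1.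
Definition dp_mul (x y : P) : P := fun i => x i * y i.
Definition dp_inv (x : P) : P := fun i => (x i)^-1.

Fact dp_mulA : associative dp_mul.
Proof. by move=> x y z; apply: functional_extensionality_dep => i; apply: mulgA. Qed.

Fact dp_mul1 : left_id dp_one dp_mul.
Proof. by move=> x; apply: functional_extensionality_dep => i; apply: mul1g. Qed.

Fact dp_mul1r : right_id dp_one dp_mul.
Proof. by move=> x; apply: functional_extensionality_dep => i; apply: mulg1. Qed.

Fact dp_mulV : left_inverse dp_one dp_inv dp_mul.
Proof. by move=> x; apply: functional_extensionality_dep => i; apply: mulVg. Qed.

Fact dp_mulVr : right_inverse dp_one dp_inv dp_mul.
Proof. by move=> x; apply: functional_extensionality_dep => i; apply: mulgV. Qed.

HB.instance Definition _ :=
  isGroup.Build P dp_mulA dp_mul1 dp_mul1r dp_mulV dp_mulVr.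

Definition finite_support : {pred P} :=
  fun x => `[< finite_set [set i | x i <> 1] >].

Fact finite_support_group : group_closed finite_support.
Proof.
split; first by apply/asboolP; apply: (sub_finite_set _ (finite_set0 I)) => i; apply.
move=> x y /asboolP fx /asboolP fy; apply/asboolP.
have fxy : finite_set ([set i | x i <> 1] `|` [set i | y i <> 1]).
  by rewrite finite_setU.
apply: (sub_finite_set _ fxy) => i /= xy1.
have [x1|] := pselect (x i = 1); last by left.
right=> y1; apply: xy1; change (x i * (y i)^-1 = 1).
by rewrite x1 y1 mulgV.
Qed.

Record restricted_product : Type := RestrictedProduct {
  rp_val : P;
  rp_finite : finite_support rp_val
}.

HB.instance Definition _ := [isSub for rp_val].
HB.instance Definition _ := [Choice of restricted_product by <:].
HB.instance Definition _ :=
  SubChoice_isSubGroup.Build P finite_support restricted_product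
    finite_support_group.

End DirectProduct.

(** * Free subgroups and their rank

    A letter [(g, true)] stands for [g] and [(g, false)] for the formal
    inverse of [g]. *)

Section Free.
Variable G : groupType.

Definition letter_val (a : G * bool) : G := if a.2 then a.1 else a.1^-1.

Definition word_val (w : seq (G * bool)) : G := \prod_(a <- w) letter_val a.

Definition word_on (X : set G) (w : seq (G * bool)) : Prop :=
  forall a, a \in w -> X a.1.

Definition cancelling (a b : G * bool) : bool :=
  (a.1 == b.1) && (a.2 != b.2).

Definition reduced (w : seq (G * bool)) : bool :=
  sorted (fun a b => ~~ cancelling a b) w.

(* The canonical map to [H] from the group of reduced words over [X] is
   bijective. *)
Definition free_basis (X : set G) (H : {pred G}) : Prop :=
  (forall x, X x -> x \in H) /\
  (forall h, h \in H -> exists! w, [/\ word_on X w, reduced w & word_val w = h]).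

Definition is_free (H : {pred G}) : Prop := exists X, free_basis X H.

(* The rank of a free group is the common cardinality of its free bases, so
   quantifying over all of them avoids choosing one.  This is vacuous when
   [H] is not free. *)
Definition rank_lt (H : {pred G}) (L : Type) : Prop :=
  forall X, free_basis X H -> card_lt X [set: L].

End Free.

(* Main.v *)
(** Fix distinct [u], [v] in a basis [X] of the free group [H].  No [h <> 1]
    in [H] commutes with all conjugates of [u v^-1] by elements of [H]: write
    [h] as a reduced word [w]; one of the reduced words
    [u u v^-1 u^-1], [v u v^-1 v^-1], [u^-1 v^-1 u u] can be concatenated
    with [w] on both sides without cancellation and starts with another letter
    than [w], so it does not commute with [w].

    Take [h <> 1] in [H] and suppose that no coordinate projection is injective
    on [X].  For each [i] in the support of [h], some [u <> v] in [X] agree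
    at [i], and the commutator of [h] with a suitable conjugate of [u v^-1] is
    a nontrivial element of [H] whose support is contained in that of [h] and
    misses [i].  As the support is finite, this cannot go on forever.  Hence [X]
    injects into a single factor [H_ i], so that [|X| <= |H_ i| < |L|]. *)
Require Import Defs.
From HB Require Import structures.
From mathcomp Require Import all_boot.
From mathcomp Require Import boolp classical_sets functions cardinality.

Set Implicit Arguments.
Unset Strict Implicit.
Unset Printing Implicit Defensive.

Local Open Scope classical_set_scope.

Section FreeBasis.
Local Open Scope group_scope.
Variables (G : groupType) (H : groupClosed G) (X : set G).
Hypothesis X_basis : free_basis X H.

Lemma word_val_cat (w1 w2 : seq (G * bool)) :
  word_val (w1 ++ w2) = word_val w1 * word_val w2.
Proof. by rewrite /word_val big_cat. Qed.

Lemma word_on_cat (w1 w2 : seq (G * bool)) :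
  word_on X w1 -> word_on X w2 -> word_on X (w1 ++ w2).
Proof. by move=> X1 X2 a; rewrite mem_cat => /orP[/X1|/X2]. Qed.

Lemma word_val_closed (w : seq (G * bool)) : word_on X w -> word_val w \in H.
Proof.
move=> Xw; rewrite /word_val; elim: w Xw => [|[x b] w IHw] Xw.
  by rewrite big_nil gpred1.
have Hx : x \in H by apply: X_basis.1; apply: (Xw (x, b)); rewrite mem_head.
rewrite big_cons gpredM ?IHw //; last by move=> a wa; apply: Xw; rewrite inE wa orbT.
by rewrite /letter_val; case: b {Xw} => //=; rewrite gpredV.
Qed.

(** Both values lie in [H], where a reduced word over [X] is unique. *)
Lemma reduced_word_inj (w1 w2 : seq (G * bool)) :
  word_on X w1 -> reduced w1 -> word_on X w2 -> reduced w2 ->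
  word_val w1 = word_val w2 -> w1 = w2.
Proof.
move=> X1 r1 X2 r2 eq12.
have [w [_ w_uniq]] := X_basis.2 _ (word_val_closed X1).
by rewrite -(w_uniq w1) // -(w_uniq w2).
Qed.

Lemma reduced_cat (a b : G * bool) (s t : seq (G * bool)) :
  reduced (a :: s) -> reduced (b :: t) -> ~~ cancelling (last a s) b ->
  reduced ((a :: s) ++ b :: t).
Proof. by rewrite /reduced /= cat_path /= => -> -> ->. Qed.

(** Both concatenations are reduced, so equal values would make them the same word, with first
    letters [a] and [b]. *)
Lemma reduced_words_noncommuting (a b : G * bool) (s t : seq (G * bool)) :
  word_on X (a :: s) -> reduced (a :: s) ->
  word_on X (b :: t) -> reduced (b :: t) ->
  ~~ cancelling (last a s) b -> ~~ cancelling (last b t) a -> a != b ->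
  ~ commute (word_val (a :: s)) (word_val (b :: t)).
Proof.
move=> Xs rs Xt rt st ts /eqP ab; rewrite /commute -!word_val_cat => eq_st.
apply: ab; have : (a :: s) ++ b :: t = (b :: t) ++ a :: s.
  by apply: reduced_word_inj => //; do ?[exact: word_on_cat|exact: reduced_cat].
by case.
Qed.

Lemma free_basis_noncommuting_conjugate (h u v : G) :
  h \in H -> h <> 1 -> X u -> X v -> u <> v ->
  exists2 g, g \in H & [~ h, (u / v) ^ g] <> 1.
Proof.
move=> Hh h1 Xu Xv uv.
have [Hu Hv] := (X_basis.1 _ Xu, X_basis.1 _ Xv).
have [uNv vNu] : (u == v) = false /\ (v == u) = false.
  by split; apply/eqP => // vu; apply: uv.
have [[|a s] [[Xs rs hE] _]] := X_basis.2 _ Hh.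
  by case: h1; rewrite -hE /word_val big_nil.
(* A word starting with [p] and ending with its inverse cancels after [a :: s] only if [p = d], and
   before it only if [p = a]. *)
set c := last a s; set d := (c.1, ~~ c.2).
pose P p := (p != a) && (p != d).
have {}wordP p t g : P p -> g \in H -> word_on X (p :: t) -> reduced (p :: t) ->
    last p t = (p.1, ~~ p.2) -> word_val (p :: t) = (u / v) ^ g ->
    exists2 g, g \in H & [~ h, (u / v) ^ g] <> 1.
  move=> /andP[pa pd] Hg Xt rt lt tE; exists g => // /eqP/commgP.
  rewrite -hE -tE; apply: reduced_words_noncommuting; rewrite // 1?eq_sym //.
    move: pd; rewrite /d /cancelling -/c; case: (c) (p) => [x b] [y b'] /=.
    by rewrite xpair_eqE [y == x]eq_sym; case: b; case: b'.
  move: pa; rewrite lt /cancelling; case: (a) (p) => [x b] [y b'] /=.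
  by rewrite xpair_eqE; case: b; case: b'.
(* Three distinct letters, of which [a] and [d] exclude at most two. *)
have [] : [\/ P (u, true), P (v, true) | P (u, false)].
  rewrite /P; move: (d) => e; have [<-|_] := eqVneq (u, true) a.
    rewrite !xpair_eqE vNu andbF /=; have [<-|_] := eqVneq (v, true) e.
      by rewrite xpair_eqE uNv; apply: Or33.
    exact: Or32.
  have [<-|_] := eqVneq (u, true) e; last exact: Or31.
  rewrite !xpair_eqE vNu !andbT !andbF /=.
  have [<-|_] := eqVneq (v, true) a; last exact: Or32.
  by rewrite xpair_eqE uNv; apply: Or33.
- move=> /(wordP _ [:: (u, true); (v, false); (u, false)] u^-1); apply.
  + by rewrite gpredV.
  + by rewrite /word_on => x; rewrite !inE => /or4P[] /eqP->.
  + by rewrite /reduced /= /cancelling /= uNv vNu !andbF.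
  + by [].
  + by rewrite /word_val !big_cons big_nil /letter_val /= conjgE invgK mulg1 !mulgA.
- move=> /(wordP _ [:: (u, true); (v, false); (v, false)] v^-1); apply.
  + by rewrite gpredV.
  + by rewrite /word_on => x; rewrite !inE => /or4P[] /eqP->.
  + by rewrite /reduced /= /cancelling /= uNv vNu !andbF.
  + by [].
  + by rewrite /word_val !big_cons big_nil /letter_val /= conjgE invgK mulg1 !mulgA.
(* Conjugating [u / v] by [v] rotates it to [v^-1 * u]; conjugating this by [u] then produces no
   cancellation. *)
- move=> /(wordP _ [:: (v, false); (u, true); (u, true)] (v * u)); apply.
  + by rewrite gpredM.
  + by rewrite /word_on => x; rewrite !inE => /or4P[] /eqP->.
  + by rewrite /reduced /= /cancelling /= uNv vNu !andbF.
  + by [].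
  + rewrite /word_val !big_cons big_nil /letter_val /= conjgE invgM mulg1 !mulgA.
    by rewrite mulgVK.
Qed.

End FreeBasis.

Section RestrictedProduct.
Local Open Scope group_scope.
Variables (K : Type) (H_ : K -> groupType).
Implicit Types x y : restricted_product H_.

Lemma rp_valF x y i : rp_val (x / y) i = rp_val x i / rp_val y i.
Proof. by []. Qed.

Lemma rp_valJ x y i : rp_val (x ^ y) i = rp_val x i ^ rp_val y i.
Proof. by []. Qed.

Lemma rp_valR x y i : rp_val [~ x, y] i = [~ rp_val x i, rp_val y i].
Proof. by []. Qed.

Lemma rp_eq1 x : (forall i, rp_val x i = 1) -> x = 1.
Proof. by move=> x1; apply: val_inj; apply: functional_extensionality_dep. Qed.

Lemma free_basis_coordinate_inj (H : groupClosed (restricted_product H_))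
    (X : set (restricted_product H_)) x :
  free_basis X H -> x \in H -> x <> 1 ->
  exists i, {in X &, injective (fun y => rp_val y i)}.
Proof.
move=> X_basis.
have [s] : exists s : seq {classic K}, [set i | rp_val x i <> 1] = [set` s].
  by apply/finite_seqP; apply/asboolP; apply: rp_finite.
(* Only the inclusion of the support in [s] is kept, since the support of a commutator may shrink by
   more than [i]. *)
move=> /seteqP[+ _]; elim: s x => [|i s IHs] x /= xs Hx x1.
  by case: x1; apply: rp_eq1 => i; apply: contrapT => /xs.
have [inj_i|/existsNP[u]] := pselect {in X &, injective (fun y => rp_val y i)}.
  by exists i.
move=> /existsNP[v] /not_implyP[/set_mem Xu] /not_implyP[/set_mem Xv].
move=> /not_implyP[uvi uv].
have [g Hg xg1] := free_basis_noncommuting_conjugate X_basis Hx x1 Xu Xv uv.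
(* A commutator is trivial wherever one of its entries is: [x] off its support, the conjugate of
   [u / v] at [i]. *)
have comm_supp j : rp_val [~ x, (u / v) ^ g] j <> 1 -> j \in (s : seq {classic K}).
  rewrite rp_valR rp_valJ rp_valF => xgj.
  have /xs/=/[!inE]/orP[/eqP ji|//] : rp_val x j <> 1.
    by move=> xj1; apply: xgj; rewrite xj1 comm1g.
  by case: xgj; rewrite ji uvi mulgV conj1g commg1.
apply: (IHs [~ x, (u / v) ^ g]) => //.
by rewrite gpredR ?gpredJ ?gpredF //; apply: X_basis.1.
Qed.

End RestrictedProduct.

Theorem theorem2p6 (K : Type) (H_ : K -> groupType) (L : Type)
    (K_infinite : infinite_set [set: K])
    (L_sup : is_card_sup (fun b : K => H_ b : Type) L)
    (L_infinite : infinite_set [set: L])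
    (H_lt : forall a : K, card_lt [set: H_ a] [set: L])
    (H : groupClosed (restricted_product H_)) (H_free : is_free H) :
  rank_lt H L.
Proof.
move=> X X_basis.
(* An empty basis provides no nontrivial element to start from; its rank is zero and [L] is
   nonempty. *)
have [->|/set0P[x Xx]] := eqVneq X set0.
  rewrite /card_lt card_ge0 card_le0; apply/eqP => L0.
  by apply: L_infinite; rewrite L0; apply: finite_set0.
(* Otherwise the empty word and the one-letter word [x] would be two reduced words for the
   identity. *)
have x1 : x <> 1%g.
  move=> x1; have : [:: (x, true)] = [::].
    apply: (reduced_word_inj X_basis) => // [a|].
      by rewrite inE => /eqP->.
    by rewrite /word_val big_seq1 big_nil.
  by [].
have [i inj_i] := free_basis_coordinate_inj X_basis (X_basis.1 _ Xx) x1.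
have /andP[HL LH] := H_lt i.
have XH : (X #<= [set: H_ i])%card.
  have := inj_card_eq inj_i; rewrite card_eq_le => /andP[_ XI].
  exact: card_le_trans XI (subset_card_le (@subsetT _ _)).
rewrite /card_lt (card_le_trans XH HL) /=.
by apply: contra LH => LX; apply: card_le_trans LX XH.
Qed.
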